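(* Let $H:\mathbb{R}^d\to\mathbb{R}^y$ satisfy, for constants $0<K_L\le K_U$, $$K_L\|\mathbf{x}_1-\mathbf{x}_2\| \le \|H(\mathbf{x}_1)-H(\mathbf{x}_2)\| \le K_U\|\mathbf{x}_1-\mathbf{x}_2\|\quad\text{for all }\mathbf{x}_1,\mathbf{x}_2\in\mathbb{R}^d,$$ with $\|\cdot\|$ the Euclidean norm. Let $\mathcal{D}$ be a distribution on $\mathbb{R}^d$ of natural queries, let $\mathbf{x},\mathbf{x}_1,\mathbf{x}_2$ be drawn from $\mathcal{D}$ with $\mathbf{x}_1,\mathbf{x}_2$ independent, and let $M_{\mathcal{D}} = \mathbb{E}[\|\mathbf{x}_1-\mathbf{x}_2\|]<\infty$. Let $\beta>0$ and let $\boldsymbol{\delta}\sim\mathcal{N}(0,\beta^2\mathbf{I}_d)$ be independent of $\mathbf{x}$. For a threshold $\tau>0$ define the detection rate $\alpha^{det}=\mathbb{P}[\|H(\mathbf{x})-H(\mathbf{x}+\boldsymbol{\delta})\|\le\tau]$ and the false positive rate $\alpha^{fp}=\mathbb{P}[\|H(\mathbf{x}_1)-H(\mathbf{x}_2)\|\le\tau]$, and assume $\alpha^{fp}<1$. Then $$\alpha^{det} \le \frac{1}{\Gamma(\frac d2)}\,\gamma\!\left(\frac d2,\ \frac12\left(\frac{K_U}{K_L}\,\frac{M_{\mathcal{D}}}{\beta}\,\frac{1}{1-\alpha^{fp}}\right)^{2}\right),$$ where $\gamma(s,x)=\int_0^x t^{s-1}e^{-t}\,dt$ is the lower incomplete Gamma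 function and $\Gamma(s)=\int_0^\infty t^{s-1}e^{-t}\,dt$ is the Gamma function.
   Context: Stateful defense model: a query is flagged as an attack query if and only if its feature vector under $H$ lies within Euclidean distance $\tau$ of the feature vector of some historical query. The attack query is $\mathbf{x}+\boldsymbol{\delta}$ with historical query $\mathbf{x}$; a false positive occurs when two independent natural queries $\mathbf{x}_1,\mathbf{x}_2$ have features within distance $\tau$. *)

(* Defs.v *)
From HB Require Import structures.
From mathcomp Require Import all_boot all_order all_algebra.
From mathcomp Require Import all_classical all_reals all_analysis.

Set Implicit Arguments.
Unset Strict Implicit.
Unset Printing Implicit Defensive.

Import Order.TTheory GRing.Theory Num.Theory.
Local Open Scope classical_set_scope.
Local Open Scope ring_scope.

(* R^n is modelled as n.-tuple R, with its product sigma-algebra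
   (measurable_tuple instance of MathComp-Analysis). *)

Definition vadd {R : realType} {n : nat} (x y : n.-tuple R) : n.-tuple R :=
  [tuple tnth x i + tnth y i | i < n].

Definition eucl_dist {R : realType} {n : nat} (x y : n.-tuple R) : R :=
  Num.sqrt (\sum_(i < n) (tnth x i - tnth y i) ^+ 2).

(* N(0, beta^2 I_n): the law whose coordinates are independent N(0, beta^2),
   i.e. its value on every measurable box is the product of the
   one-dimensional normal probabilities (mean 0, standard deviation beta).
   Boxes generate the product sigma-algebra, so this determines the law. *)
Definition isotropic_gaussian {R : realType} (n : nat) (beta : R)
    (N : probability (n.-tuple R) R) : Prop :=
  forall A : 'I_n -> set R, (forall i, measurable (A i)) ->
    N [set x | forall i, A i (tnth x i)] =
      (\prod_(i < n) normal_prob 0 beta (A i))%E.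

Definition lower_inc_gamma {R : realType} (s x : R) : R :=
  fine (\int[@lebesgue_measure R]_(t in [set t : R | (0 < t <= x)%R])
          (powR t (s - 1) * expR (- t))%R%:E)%E.

Definition Gamma_fun {R : realType} (s : R) : R :=
  fine (\int[@lebesgue_measure R]_(t in [set t : R | (0 < t)%R])
          (powR t (s - 1) * expR (- t))%R%:E)%E.

(* Main.v *)
Require Import Defs.
From HB Require Import structures.
From mathcomp Require Import all_boot all_order all_algebra.
From mathcomp Require Import all_classical all_reals all_analysis.
From mathcomp Require Import measurable_realfun ring lra.

Import Order.TTheory GRing.Theory Num.Theory.
Import numFieldNormedType.Exports.
Local Open Scope classical_set_scope.
Local Open Scope ring_scope.

(** Markov's inequality applied to [eucl_dist x1 x2] gives
    [tau * (1 - alpha_fp) <= KU * M], and the lower Lipschitz bound shows that a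
    detected query has noise of norm at most [tau / KL].  It remains to compute
    the Gaussian mass of a centred ball.  By induction on the dimension, the
    squared norm of a Gaussian vector of [R^(n+1)] integrates [f] as
    [c * \int f(r^2) |r|^n exp(- r^2 / (2 beta^2)) dr]; the induction step only
    uses the linear substitutions [x = |r| v] and [r = rho / sqrt (1 + v^2)].
    The constant [c] is never computed: taking [f = 1] identifies it through
    [Gamma (d/2)] after the substitution [t = r^2 / (2 beta^2)]. *)

(** * Boxes determine a finite measure on tuples; splitting off one Gaussian coordinate *)

Section tuple_box.
Local Open Scope ereal_scope.
Context (R : realType).

Lemma measurable_box n (A : 'I_n -> set R) : (forall i, measurable (A i)) ->
  measurable [set x : n.-tuple R | forall i, A i (tnth x i)].
Proof.
move=> mA; rewrite [X in measurable X](_ : _ =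
    \bigcap_(i in [set: 'I_n]) ((@tnth n R) ^~ i @^-1` A i)); last first.
  by apply/seteqP; split=> [x Ax i _|x Ax i]; [exact: Ax|exact: (Ax i)].
apply: fin_bigcap_measurable => // i _; rewrite -[X in measurable X]setTI.
exact: measurable_tnth.
Qed.

(** Boxes are stable under intersection and generate the product sigma-algebra, so the pi-lambda
    uniqueness theorem applies. Since the whole space is itself a box of finite [m1]-mass, the
    constant sequence [setT] serves as the exhausting cover. *)
Lemma box_measure_unique n (m1 m2 : {measure set (n.-tuple R) -> \bar R}) :
  m1 setT < +oo ->
  (forall A : 'I_n -> set R, (forall i, measurable (A i)) ->
    m1 [set x | forall i, A i (tnth x i)] =
    m2 [set x | forall i, A i (tnth x i)]) ->
  forall B, measurable B -> m1 B = m2 B.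
Proof.
move=> m1oo m12.
pose G : set (set (n.-tuple R)) := [set B | exists A : 'I_n -> set R,
  (forall i, measurable (A i)) /\ B = [set x | forall i, A i (tnth x i)]].
have GT : G setT.
  exists (fun=> setT); split=> //; apply/seteqP; split=> // x _ i //.
apply: (measure_unique G (fun=> setT)) => //.
- apply/seteqP; split.
  + apply: smallest_sub; first exact: smallest_sigma_algebra.
    move=> B; rewrite -bigcup_seq => -[/= i _ [A mA <-]]; rewrite setTI.
    (* A cylinder over coordinate [i] is the box whose other sides are the full line. *)
    apply: sub_sigma_algebra; exists (fun j => if j == i then A else setT).
    split=> [j|]; first by case: ifP.
    apply/seteqP; split=> x /=; last by move=> /(_ i); rewrite eqxx.
    by move=> Ax j; case: eqP => // ->.
  + apply: smallest_sub; first exact: sigma_algebra_measurable.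
    by move=> _ [A [mA ->]]; exact: measurable_box.
- move=> _ _ [A [mA ->]] [B [mB ->]]; exists (fun i => A i `&` B i); split.
    by move=> i; exact: measurableI.
  apply/seteqP; split=> x /=; first by move=> [Ax Bx] i; split.
  by move=> ABx; split=> i; have [] := ABx i.
- by apply/seteqP; split=> // x _; exists 0%N.
- by move=> _ [A [mA ->]]; exact: m12.
Qed.

(** This feeds the induction on the dimension. [N'] is the law of the tail; [N] and the image of the
    product of a normal law with [N'] under cons agree on boxes, hence everywhere, and Tonelli
    splits the integral. *)
Lemma isotropic_gaussian_cons n (beta : R) (N : probability (n.+1.-tuple R) R) :
  isotropic_gaussian beta N ->
  exists2 N' : probability (n.-tuple R) R, isotropic_gaussian beta N' &
  forall f : n.+1.-tuple R -> \bar R,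
    measurable_fun setT f -> (forall x, 0 <= f x) ->
    \int[N]_x f x =
    \int[N']_y \int[normal_prob 0 beta]_x f [tuple of x :: y].
Proof.
move=> gN.
pose tl : {mfun n.+1.-tuple R >-> n.-tuple R} := HB.pack
  (fun x : n.+1.-tuple R => [tuple of behead x] : n.-tuple R)
  (isMeasurableFun.Build _ _ _ _ _ (@measurable_behead _ R n)).
pose N' : probability (n.-tuple R) R := distribution N tl.
have gN' : isotropic_gaussian beta N'.
  move=> A mA; rewrite /N' /= /distribution /pushforward /=.
  (* A box for the tail is padded by a full side at the head, which contributes the factor 1. *)
  pose B (j : 'I_n.+1) := if unlift ord0 j is Some i then A i else setT.
  have -> : \prod_(i < n) normal_prob 0 beta (A i) =
            \prod_(i < n.+1) normal_prob 0 beta (B i).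
    rewrite big_ord_recl {1}/B unlift_none probability_setT mul1e.
    by apply: eq_bigr => i _; rewrite /B liftK.
  rewrite -gN; last by move=> j; rewrite /B; case: unliftP => [i _|_].
  congr (N _); apply/seteqP; split=> x /= Ax.
    move=> j; rewrite /B; case: unliftP => [i ->|->//].
    have := Ax i; rewrite tnth_behead (_ : inord _ = lift ord0 i)//.
    by apply/val_inj; rewrite /= inordK// ltnS.
  move=> i; have := Ax (lift ord0 i); rewrite /B liftK tnth_behead.
  by rewrite (_ : inord _ = lift ord0 i)//; apply/val_inj; rewrite /= inordK// ltnS.
exists N' => // f mf f0.
pose P : probability (measurableTypeR R) R := normal_prob 0 beta.
have mc : measurable_fun [set: measurableTypeR R * n.-tuple R]
    (fun z : measurableTypeR R * n.-tuple R => [the n.+1.-tuple R of z.1 :: z.2]).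
  exact: measurable_cons.
pose c : {mfun (measurableTypeR R * n.-tuple R)%type >-> n.+1.-tuple R} := HB.pack
  (fun z : measurableTypeR R * n.-tuple R => [the n.+1.-tuple R of z.1 :: z.2])
  (isMeasurableFun.Build _ _ _ _ _ mc).
pose Q : probability (measurableTypeR R * n.-tuple R)%type R := (P \x N').
have NE B : measurable B -> N B = distribution Q c B.
  apply: (@box_measure_unique _ N (distribution Q c)).
    by rewrite (le_lt_trans (probability_le1 N _))// ltry.
  move=> A mA; apply: (etrans (gN A mA)).
  rewrite /distribution /= /pushforward /=.
  rewrite [X in _ = Q X](_ : _ = A ord0 `*`
    [set x | forall i, A (lift ord0 i) (tnth x i)]); last first.
    apply/seteqP; split=> -[x y] /=.
      move=> Axy; split; first exact: (Axy ord0).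
      by move=> i; have := Axy (lift ord0 i); rewrite tnthS.
    move=> [Ax Ay] i; case: (unliftP ord0 i) => [j ->|->//]; rewrite tnthS.
    exact: Ay.
  rewrite big_ord_recl -gN'//; apply/esym.
  by apply: (product_measure1E P N');
    [exact: mA|exact: (@measurable_box _ (fun i => A (lift ord0 i)) (fun i => mA _))].
rewrite (eq_measure_integral (distribution Q c)); last by move=> B mB _; exact: NE.
rewrite ge0_integral_distribution//=.
rewrite /Q (fubini_tonelli2 (m1 := P) (m2 := N') (f \o c))//.
- exact: measurableT_comp mf mc.
- by move=> x; exact: f0.
Qed.
End tuple_box.

(** * Integration against a measure given by a density *)

Section density.
Local Open Scope ereal_scope.
Context d (T : measurableType d) (R : realType).
Variables (mu nu : {measure set T -> \bar R}) (g : T -> R).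
Hypotheses (mg : measurable_fun setT g) (g0 : forall x, (0 <= g x)%R).
Hypothesis nuE : forall A, measurable A -> nu A = \int[mu]_(x in A) (g x)%:E.

Import HBNNSimple.

Let integral_density_nnsfun (h : {nnsfun T >-> R}) :
  \int[nu]_x (h x)%:E = \int[mu]_x ((h x)%:E * (g x)%:E).
Proof.
under [LHS]eq_integral do rewrite fimfunE -fsumEFin//.
rewrite [LHS]ge0_integral_fsum//; last 2 first.
  - by move=> r; exact/measurable_EFinP/measurableT_comp.
  - by move=> n x _; rewrite EFinM nnfun_muleindic_ge0.
transitivity (\int[mu]_x \sum_(k \in range h)
    (k * \1_(h @^-1` [set k]) x)%:E * (g x)%:E); last first.
  apply: eq_integral => x _; rewrite -ge0_mule_fsuml.
    by rewrite [in RHS]fimfunE -fsumEFin.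
  by move=> k; rewrite EFinM nnfun_muleindic_ge0.
rewrite ge0_integral_fsum//; last 2 first.
  - move=> r; apply: emeasurable_funM; last exact/measurable_EFinP.
    exact/measurable_EFinP/measurableT_comp.
  - by move=> n x _; apply: mule_ge0; [rewrite EFinM nnfun_muleindic_ge0|rewrite lee_fin].
apply: eq_fsbigr => r /set_mem [x _ <-].
under [RHS]eq_integral do rewrite EFinM -muleA.
under [LHS]eq_integral do rewrite EFinM.
rewrite !ge0_integralZl ?lee_fin//; last 3 first.
- apply: emeasurable_funM; last exact/measurable_EFinP.
  exact/measurable_EFinP.
- by move=> y _; rewrite mule_ge0 ?lee_fin.
- exact/measurable_EFinP.
congr (_ * _); rewrite integral_indic// setIT nuE// integral_mkcond.
by apply: eq_integral => y _; rewrite epatch_indic/= muleC.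
Qed.

(** For simple functions the identity follows from [nuE] by linearity; monotone convergence along
    [nnsfun_approx] carries it to every nonnegative measurable function. *)
Lemma ge0_integral_density (f : T -> \bar R) :
  measurable_fun setT f -> (forall x, 0 <= f x) ->
  \int[nu]_x f x = \int[mu]_x (f x * (g x)%:E).
Proof.
move=> mf f0; pose f_ := nnsfun_approx measurableT mf.
transitivity (limn (fun n => \int[nu]_x (f_ n x)%:E)).
  rewrite -monotone_convergence//=.
  - apply: eq_integral => x _; apply/esym/cvg_lim => //=.
    exact: cvg_nnsfun_approx.
  - by move=> n; exact/measurable_EFinP.
  - by move=> n x _; rewrite lee_fin.
  - by move=> x _ a b ab; rewrite lee_fin//; exact/lefP/nd_nnsfun_approx.
under eq_fun do rewrite integral_density_nnsfun.
rewrite -monotone_convergence//=.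
- apply: eq_integral => x _; apply/cvg_lim => //=.
  by apply: cvgeZr => //; exact: cvg_nnsfun_approx.
- by move=> n; apply: emeasurable_funM; last exact/measurable_EFinP; exact/measurable_EFinP.
- by move=> n x _; rewrite mule_ge0// lee_fin.
- move=> x _ a b ab; rewrite lee_wpmul2r ?lee_fin//.
  exact/lefP/nd_nnsfun_approx.
Qed.
End density.

(** * Linear substitutions on the real line and the polar-type exchange of integrals *)

Section scaling.
Local Open Scope ereal_scope.
Context (R : realType).
Notation mu := (@lebesgue_measure R).

(** Lebesgue measure equals [a] times its pushforward under multiplication by [a]: both agree on
    half-open intervals, whose preimages have length divided by [a]. *)
Lemma ge0_integral_scale (a : R) (f : R -> \bar R) : (0 < a)%R ->
  measurable_fun setT f -> (forall x, 0 <= f x) ->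
  \int[mu]_x f x = a%:E * \int[mu]_x f (a * x)%R.
Proof.
move=> a0 mf f0.
have ma : measurable_fun [set: measurableTypeR R] ( *%R a : _ -> measurableTypeR R).
  exact: mulrl_measurable.
pose m := mscale (NngNum (ltW a0)) (pushforward mu ( *%R a : _ -> measurableTypeR R)).
have muE A : measurable A -> mu A = m ma A.
  apply: lebesgue_measure_unique => _ [[b c]] _ <-.
  rewrite /m /mscale /= /pushforward.
  rewrite [X in _ = _ * mu X](_ : _ = `]b / a, c / a]%classic)%R; last first.
    apply/seteqP; split => x /=; rewrite !in_itv/=;
      by rewrite ltr_pdivrMr// ler_pdivlMr// ![(x * a)%R]mulrC.
  rewrite !lebesgue_measure_itv/= !lte_fin ltr_pM2r ?invr_gt0//.
  case: ifPn => _; last by rewrite mule0.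
  by rewrite -!EFinD -EFinM; congr EFin; field; rewrite gt_eqF.
rewrite [LHS](eq_measure_integral (m ma)); last by move=> A mA _; exact: muE.
rewrite ge0_integral_mscale//; congr (_ * _).
by rewrite ge0_integral_pushforward.
Qed.

(* Substitute [x = |r| v], exchange the integrals, then [r = rho / sqrt (1 + v^2)]. *)
Lemma ge0_integral_sqnorm (n : nat) (G : R -> \bar R) :
  measurable_fun setT G -> (forall x, 0 <= G x) ->
  \int[mu]_r \int[mu]_x (G (x ^+ 2 + r ^+ 2)%R * (`|r| ^+ n)%:E) =
  \int[mu]_v (Num.sqrt (1 + v ^+ 2) ^- n.+2)%:E *
  \int[mu]_r (G (r ^+ 2)%R * (`|r| ^+ n.+1)%:E).
Proof.
move=> mG G0.
have mabs k : measurable_fun [set: R] (fun r : R => (`|r| ^+ k)%:E).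
  by apply/measurable_EFinP; apply: measurable_funX; exact: normr_measurable.
have mh d (T : measurableType d) (h j : T -> R) k :
    measurable_fun setT h -> measurable_fun setT j ->
    measurable_fun setT (fun x => G (h x) * (`|j x| ^+ k)%:E).
  move=> mh mj; apply: emeasurable_funM; first exact: measurableT_comp mG mh.
  exact: measurableT_comp (mabs k) mj.
have h0 k x (r : R) : 0 <= G x * (`|r| ^+ k)%:E by rewrite mule_ge0// lee_fin exprn_ge0.
have m1 : measurable_fun [set: R * R] (fun z : R * R => (z.2 ^+ 2 + z.1 ^+ 2)%R).
  by apply: measurable_funD; apply: measurable_funX.
have m2 : measurable_fun [set: R * R] (fun z : R * R => (z.1 ^+ 2 * (1 + z.2 ^+ 2))%R).
  apply: measurable_funM; first exact: measurable_funX.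
  by apply: measurable_funD => //; exact: measurable_funX.
have m2' r : measurable_fun [set: R] (fun v : R => (r ^+ 2 * (1 + v ^+ 2))%R).
  apply: measurable_funM => //.
  by apply: measurable_funD => //; exact: measurable_funX.
have ms : measurable_fun [set: R] (fun v : R => (Num.sqrt (1 + v ^+ 2) ^- n.+2)%R).
  apply: continuous_measurable_fun => v; apply: cvgV.
    by rewrite expf_neq0// gt_eqF// sqrtr_gt0 ltr_wpDr// sqr_ge0.
  apply: (cvg_comp (fun v => Num.sqrt (1 + v ^+ 2)) (fun x => x ^+ n.+2)%R);
    last exact: exprn_continuous.
  apply: (cvg_comp (fun v => 1 + v ^+ 2)%R Num.sqrt); last exact: sqrt_continuous.
  by apply: cvgD; [exact: cvg_cst|exact: exprn_continuous].
have FT (h : R * R -> \bar R) : measurable_fun setT h -> (forall z, 0 <= h z) ->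
    \int[mu]_r \int[mu]_x h (r, x) = \int[mu]_x \int[mu]_r h (r, x).
  by move=> ? ?; exact: (fubini_tonelli (m1 := mu) (m2 := mu)).
transitivity (\int[mu]_r \int[mu]_v
    (G (r ^+ 2 * (1 + v ^+ 2))%R * (`|r| ^+ n.+1)%:E)).
  have mF (h : R * R -> \bar R) : measurable_fun setT h -> (forall z, 0 <= h z) ->
      measurable_fun setT (fun r => \int[mu]_x h (r, x)).
    by move=> ? ?; exact: measurable_fun_fubini_tonelli_F.
  (* The null point [r = 0] is discarded, because scaling by [|r|] requires a positive factor. *)
  have D0 (F : R -> \bar R) : measurable_fun setT F ->
      \int[mu]_x F x = \int[mu]_(x in [set: R] `\ 0%R) F x.
    move=> mf; apply/esym/integral_setD1; first exact: measurableD.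
    exact: measurable_funTS.
  rewrite D0; last first.
    apply: (mF (fun z => G (z.2 ^+ 2 + z.1 ^+ 2)%R * (`|z.1| ^+ n)%:E)) => //=.
    exact: mh.
  rewrite [RHS]D0; last first.
    apply: (mF (fun z => G (z.1 ^+ 2 * (1 + z.2 ^+ 2))%R * (`|z.1| ^+ n.+1)%:E)) => //=.
    exact: mh.
  apply: eq_integral => r; rewrite inE/= => -[_ /eqP r0].
  rewrite (@ge0_integral_scale `|r|) ?normr_gt0//; last first.
    apply: mh => //; apply: measurable_funD => //; exact: measurable_funX.
  rewrite -ge0_integralZl//; last first.
    apply: mh => //; apply: measurable_funD => //; apply: measurable_funX.
    exact: mulrl_measurable.
  apply: eq_integral => x _; rewrite muleCA -EFinM -exprS; congr (G _ * _).
  by rewrite exprMn real_normK ?num_real//; ring.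
rewrite [LHS](_ : _ = \int[mu]_v \int[mu]_r
    (G (r ^+ 2 * (1 + v ^+ 2))%R * (`|r| ^+ n.+1)%:E)); last first.
  apply: (FT (fun z : R * R =>
    G (z.1 ^+ 2 * (1 + z.2 ^+ 2))%R * (`|z.1| ^+ n.+1)%:E)) => //.
  exact: mh.
rewrite -ge0_integralZr//; last 2 first.
- exact/measurable_EFinP.
- exact: integral_ge0.
apply: eq_integral => v _.
have s0 : (0 < Num.sqrt (1 + v ^+ 2))%R.
  by rewrite sqrtr_gt0 ltr_wpDr// sqr_ge0.
have mr : measurable_fun [set: R] (fun r : R => r ^+ 2)%R by exact: measurable_funX.
have ma (a : R) : measurable_fun [set: R] ( *%R a) by exact: mulrl_measurable.
(* With [s = sqrt (1 + v^2)], the Jacobian [s] and the factor [s^(n+1)] from the power together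
   cancel [s^-(n+2)]. *)
rewrite [in RHS](ge0_integral_scale _ _ s0)//; last exact: mh.
rewrite muleA -EFinM -ge0_integralZl//; last first.
  by apply: mh => //; exact: measurable_funX.
apply: eq_integral => r _; rewrite muleCA -EFinM; congr (G _ * _%:E).
  by rewrite exprMn sqr_sqrtr 1?mulrC// addr_ge0// sqr_ge0.
rewrite normrM (gtr0_norm s0) exprMn; set s := Num.sqrt _ in s0 *.
by rewrite mulrA -(mulrA _ s) -exprS mulVf ?mul1r// expf_neq0// gt_eqF.
Qed.
End scaling.

(** * The substitution [t = c r^2] in complete and incomplete Gamma integrals *)

Section gamma_subst.
Local Open Scope ereal_scope.
Context (R : realType).
Notation mu := (@lebesgue_measure R).

Lemma ge0_integral_even (f : R -> \bar R) : measurable_fun setT f ->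
  (forall x, 0 <= f x) -> (forall x, f (- x)%R = f x) ->
  \int[mu]_x f x = 2%:E * \int[mu]_(x in `]0%R, +oo[) f x.
Proof.
move=> mf f0 fN.
have E : \int[mu]_(x in `[0%R, +oo[) f x = \int[mu]_(x in `]0%R, +oo[) f x.
  apply/esym; apply: integral_itv_obnd_cbnd; exact: measurable_funTS.
rewrite (_ : [set: R] = `]-oo, 0%R] `|` `]0%R, +oo[); last first.
  by apply/seteqP; split=> // x _ /=; rewrite !in_itv/= andbT; case: leP; [left|right].
rewrite ge0_integral_setU//=; last 2 first.
- exact: measurable_funTS.
- apply/disj_setPS => x [] /=; rewrite !in_itv/= andbT => x0.
  by rewrite ltNge x0.
rewrite [X in X + _](_ : _ = \int[mu]_(x in `]-oo, 0%R]) f (- x)%R); last first.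
  by apply: eq_integral => x _; rewrite fN.
rewrite -ge0_integration_by_substitution0// E.
by rewrite (_ : 2%:E = 1 + 1)// ge0_muleDl// mul1e.
Qed.

(** With [t = c r^2] and [dt = 2 c r dr], the powers of [r] combine to [r^n]. The segment stays away
    from 0, where the power of [t] is discontinuous for [n = 0]. *)
Lemma integral_gamma_sqr_itv n (c a b : R) : (0 < c)%R -> (0 < a)%R -> (a <= b)%R ->
  \int[mu]_(t in `[(c * a ^+ 2)%R, (c * b ^+ 2)%R])
     (powR t (n.+1%:R / 2 - 1) * expR (- t))%:E =
  (2 * powR c (n.+1%:R / 2))%:E *
  \int[mu]_(r in `[a, b]) (r ^+ n * expR (- (c * r ^+ 2)))%:E.
Proof.
move=> c0 a0 ab.
pose F (r : R) := (c * r ^+ 2)%R.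
have dF (x : R) : is_derive x (1%R : R) (F : R -> R) (2 * c * x)%R.
  rewrite /F; apply: is_derive_eq; rewrite /GRing.scale/=; ring.
have F'E : F^`()%classic = (fun x => 2 * c * x)%R.
  by apply/funext => x; rewrite derive1E; apply: derive_val.
have cF' : continuous F^`()%classic.
  by rewrite F'E; exact: mulrl_continuous.
have cF : continuous F.
  move=> x; apply: differentiable_continuous; apply/derivable1_diffP.
  exact: (@ex_derive _ _ _ _ _ _ _ (dF x)).
rewrite (@integration_by_substitution_increasing _ F
  (fun t => powR t (n.+1%:R / 2 - 1) * expR (- t))%R)//.
- rewrite -ge0_integralZl//=; last 3 first.
  + apply/measurable_EFinP/measurable_funTS/measurable_funM.
      exact: measurable_funX.
    apply: measurableT_comp => //; apply: measurableT_comp => //.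
    by apply: measurable_funM => //; exact: measurable_funX.
  + move=> r; rewrite in_itv/= => /andP[ar _].
    by rewrite lee_fin mulr_ge0 ?expR_ge0// exprn_ge0// (le_trans (ltW a0)).
  + by rewrite lee_fin mulr_ge0// powR_ge0.
  apply: eq_integral => r; rewrite inE/= in_itv/= => /andP[ar rb].
  have r0 := lt_le_trans a0 ar.
  rewrite -EFinM; congr EFin; rewrite F'E fctE/= /F.
  have cr0 : (c * r ^+ 2 != 0)%R by rewrite mulf_neq0 ?expf_neq0// gt_eqF.
  rewrite powRB ?cr0 ?implybT// powRr1; last by rewrite mulr_ge0 ?sqr_ge0 ?ltW.
  have rn : powR (r ^+ 2) (n.+1%:R / 2) = (r ^+ n.+1)%R.
    rewrite -powR_mulrn ?ltW// -powRrM mulrCA divff// mulr1.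
    by rewrite powR_mulrn// ltW.
  rewrite powRM ?sqr_ge0 ?ltW// rn exprS.
  by field; rewrite !gt_eqF.
- move=> x y; rewrite !in_itv/= => /andP[ax _] /andP[ay _] xy.
  by rewrite ltr_pM2l// ltr_pXn2r// nnegrE ltW// (lt_le_trans a0).
- apply/cvg_ex; exists (F^`()%classic a); apply: cvg_at_right_filter; exact: (cF' _).
- apply/cvg_ex; exists (F^`()%classic b); apply: cvg_at_left_filter; exact: (cF' _).
- split.
  + by move=> x _; apply: ex_derive.
  + apply: cvg_at_right_filter; exact: cF.
  + apply: cvg_at_left_filter; exact: cF.
- apply: continuous_in_subspaceT => x; rewrite inE/= in_itv/= => /andP[Fx _].
  have x0 : (0 < x)%R by rewrite (lt_le_trans _ Fx)// mulr_gt0// exprn_gt0.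
  apply: cvgM; last first.
    apply: (cvg_comp (fun x : R => - x)%R expR); last exact: continuous_expR.
    exact: cvgN.
  have /derivable1_diffP/differentiable_continuous :
      derivable (fun t : R => powR t (n.+1%:R / 2 - 1)) x (1%R : R).
    by apply: derivable_powR; rewrite in_itv/= andbT.
  exact.
Qed.

(** Both sides are monotone limits of integrals over growing segments, matched term by term by the
    previous lemma. One statement thus serves both the half-line and the interval []0, rho]]. *)
Lemma integral_gamma_sqr_bigcup n (c : R) (a b : R^nat) : (0 < c)%R ->
  (forall k, 0 < a k)%R -> (forall k, a k <= b k)%R ->
  nonincreasing_seq a -> nondecreasing_seq b ->
  \int[mu]_(t in [set t | (0 < t)%R /\
      (\bigcup_k `[a k, b k]%classic) (Num.sqrt (t / c))])
     (powR t (n.+1%:R / 2 - 1) * expR (- t))%:E =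
  (2 * powR c (n.+1%:R / 2))%:E *
  \int[mu]_(r in \bigcup_k `[a k, b k]%classic)
     (r ^+ n * expR (- (c * r ^+ 2)))%:E.
Proof.
move=> c0 a0 ab na nb.
have ca k : (0 < c * a k ^+ 2)%R by rewrite mulr_gt0// exprn_gt0.
rewrite [X in integral _ X](_ : _ =
    \bigcup_k `[(c * a k ^+ 2)%R, (c * b k ^+ 2)%R]%classic); last first.
  have tE k t : (0 < t)%R -> (t \in `[c * a k ^+ 2, c * b k ^+ 2])%R =
      (Num.sqrt (t / c) \in `[a k, b k])%R.
    move=> t0; rewrite !in_itv/= [(c * a k ^+ 2)%R]mulrC [(c * b k ^+ 2)%R]mulrC.
    rewrite -(ler_pdivlMr _ _ c0) -(ler_pdivrMr _ _ c0).
    have b0 : (0 < b k)%R by rewrite (lt_le_trans (a0 k)).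
    have tc : (0 <= t / c)%R by rewrite divr_ge0// ltW.
    rewrite -(ler_sqrt _ tc) -(ler_sqrt _ (sqr_ge0 (b k))).
    by rewrite !sqrtr_sqr !gtr0_norm.
  apply/seteqP; split=> t /=.
    by move=> [t0 [k _ /= kt]]; exists k => //=; rewrite tE.
  move=> [k _ /= kt].
  have t0 : (0 < t)%R by move: kt; rewrite in_itv/= => /andP[+ _]; exact: lt_le_trans.
  by split=> //; exists k => //=; rewrite -tE.
have mw D : measurable_fun D (fun r : R => (r ^+ n * expR (- (c * r ^+ 2)))%:E).
  apply/measurable_EFinP/measurable_funTS/measurable_funM.
    exact: measurable_funX.
  apply: measurableT_comp => //; apply: measurableT_comp => //.
  by apply: measurable_funM => //; exact: measurable_funX.
have mp D : measurable_fun D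
    (fun t : R => (powR t (n.+1%:R / 2 - 1) * expR (- t))%:E).
  apply/measurable_EFinP/measurable_funTS/measurable_funM.
    exact: measurable_powR.
  by apply: measurableT_comp.
have lhs : (\int[mu]_(t in `[(c * a k ^+ 2)%R, (c * b k ^+ 2)%R])
     (powR t (n.+1%:R / 2 - 1) * expR (- t))%:E) @[k --> \oo] -->
    \int[mu]_(t in \bigcup_k `[(c * a k ^+ 2)%R, (c * b k ^+ 2)%R]%classic)
     (powR t (n.+1%:R / 2 - 1) * expR (- t))%:E.
  apply: ge0_nondecreasing_set_cvg_integral => //.
    move=> i j ij; rewrite subsetEset; apply: subset_itv; rewrite bnd_simp ler_pM2l//.
      by rewrite ler_pXn2r ?na// nnegrE ltW.
    by rewrite ler_pXn2r ?nb// nnegrE ltW// (lt_le_trans (a0 _) (ab _)).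
    by move=> k; exact: mp.
  by move=> k t _; rewrite lee_fin mulr_ge0 ?powR_ge0 ?expR_ge0.
have rhs : (\int[mu]_(r in `[a k, b k]) (r ^+ n * expR (- (c * r ^+ 2)))%:E)
      @[k --> \oo] -->
    \int[mu]_(r in \bigcup_k `[a k, b k]%classic) (r ^+ n * expR (- (c * r ^+ 2)))%:E.
  apply: ge0_nondecreasing_set_cvg_integral => //.
    move=> i j ij; rewrite subsetEset; apply: subset_itv; rewrite bnd_simp.
      exact: na.
    exact: nb.
  by move=> k; exact: mw.
  move=> k r /=; rewrite in_itv/= => /andP[ar _].
  by rewrite lee_fin mulr_ge0 ?expR_ge0// exprn_ge0// (le_trans (ltW (a0 k))).
move: lhs; under eq_fun do rewrite integral_gamma_sqr_itv//; move=> lhs.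
apply: (cvg_unique _ lhs) => //.
exact: cvgeZl.
Qed.

Lemma integral_gamma_sqrT n (c : R) : (0 < c)%R ->
  \int[mu]_(t in [set t | (0 < t)%R])
     (powR t (n.+1%:R / 2 - 1) * expR (- t))%:E =
  (2 * powR c (n.+1%:R / 2))%:E *
  \int[mu]_(r in `]0%R, +oo[) (r ^+ n * expR (- (c * r ^+ 2)))%:E.
Proof.
move=> c0.
have U : `]0%R, +oo[%classic = \bigcup_k `[(k.+1%:R^-1)%R, (k.+1%:R)%R : R]%classic.
  apply/seteqP; split=> r /=; last first.
    move=> [k _ /=]; rewrite !in_itv/= andbT => /andP[+ _]; exact: lt_le_trans.
  rewrite in_itv/= andbT => r0.
  (* The successor of this index exceeds both [r] and [1 / r]. *)
  exists (maxn (Num.trunc r) (Num.trunc r^-1)) => //=.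
  rewrite in_itv/= -[leRHS]invrK lef_pV2 ?posrE ?invr_gt0//; apply/andP; split.
    rewrite (le_trans (ltW (truncnS_gt _)))// ler_nat ltnS leq_maxr//.
  by rewrite (le_trans (ltW (truncnS_gt _)))// ler_nat ltnS leq_maxl.
rewrite U -integral_gamma_sqr_bigcup//.
- congr (integral _ _ _); apply/seteqP; split=> t /=; last by case.
  move=> t0; split=> //; rewrite -U/= in_itv/= andbT sqrtr_gt0 divr_gt0//.
- by move=> k; rewrite (@le_trans _ _ 1%R) ?invf_le1 ?ler1n// ltr0n.
- by move=> i j ij; rewrite lef_pV2 ?posrE// ler_nat.
- by move=> i j ij; rewrite ler_nat.
Qed.

Lemma integral_gamma_sqr n (c rho : R) : (0 < c)%R -> (0 <= rho)%R ->
  \int[mu]_(t in [set t | (0 < t <= c * rho ^+ 2)%R])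
     (powR t (n.+1%:R / 2 - 1) * expR (- t))%:E =
  (2 * powR c (n.+1%:R / 2))%:E *
  \int[mu]_(r in `]0%R, rho]) (r ^+ n * expR (- (c * r ^+ 2)))%:E.
Proof.
(* For [rho = 0] both domains are empty; the segments [[rho / (k+1), rho]] exhaust []0, rho]] only
   when [rho] is positive. *)
move=> c0; rewrite le_eqVlt => /predU1P[<-|r0].
  by rewrite expr0n mulr0 set_itvoc0 !integral_set0 mule0.
have srho : rho = Num.sqrt (rho ^+ 2) by rewrite sqrtr_sqr gtr0_norm.
have U : `]0%R, rho]%classic = \bigcup_k `[(rho / k.+1%:R)%R, rho]%classic.
  apply/seteqP; split=> r /=; last first.
    move=> [k _ /=]; rewrite !in_itv/= => /andP[+ ->]; rewrite andbT.
    by apply: lt_le_trans; rewrite divr_gt0.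
  rewrite in_itv/= => /andP[s0 rr]; exists (Num.trunc (rho / r)) => //=.
  rewrite in_itv/= rr andbT ler_pdivrMr// mulrC -ler_pdivrMr//.
  exact/ltW/truncnS_gt.
rewrite U -integral_gamma_sqr_bigcup//.
- congr (integral _ _ _); apply/seteqP; split=> t /=.
    move=> /andP[t0 tr]; split=> //; rewrite -U/= in_itv/= sqrtr_gt0 divr_gt0//=.
    rewrite [leRHS]srho ler_sqrt ?sqr_ge0//.
    by rewrite ler_pdivrMr// mulrC.
  move=> [t0]; rewrite -U/= in_itv/= => /andP[_]; rewrite t0/=.
  rewrite [leRHS]srho ler_sqrt ?sqr_ge0//.
  by rewrite ler_pdivrMr// mulrC.
- by move=> k; rewrite divr_gt0.
- by move=> k; rewrite ler_pdivrMr// ler_peMr ?ler1n// ltW.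
- by move=> i j ij; rewrite ler_pM2l// lef_pV2 ?posrE// ler_nat.
Qed.
End gamma_subst.

(** * The law of the norm of an isotropic Gaussian vector *)

Section chi.
Local Open Scope ereal_scope.
Context (R : realType).
Notation mu := (@lebesgue_measure R).
Variables (beta : R) (beta0 : (0 < beta)%R).

(** The unnormalised radial weight in dimension [n + 1], extended evenly to the whole line; [w 0] is
    the normal density without its peak factor. *)
Let w (n : nat) (r : R) : R := (`|r| ^+ n * expR (- ((2 * beta ^+ 2)^-1 * r ^+ 2)))%R.

Let measurable_w n : measurable_fun setT (w n).
Proof.
apply: measurable_funM; first by apply: measurable_funX.
apply: measurableT_comp => //; apply: measurableT_comp => //.
by apply: measurable_funM => //; exact: measurable_funX.
Qed.

Let measurable_Ew n : measurable_fun setT (fun r => (w n r)%:E).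
Proof. exact/measurable_EFinP. Qed.

Let w_ge0 n r : (0 <= w n r)%R.
Proof. by rewrite mulr_ge0 ?expR_ge0// exprn_ge0. Qed.

Let integral_normal (f : R -> \bar R) :
  measurable_fun setT f -> (forall x, 0 <= f x) ->
  \int[normal_prob 0 beta]_x f x =
  (normal_peak beta)%:E * \int[mu]_x (f x * (w 0 x)%:E).
Proof.
move=> mf f0.
rewrite (@ge0_integral_density _ _ _ mu (normal_prob 0 beta) (normal_pdf 0 beta))//; last 2 first.
- exact: measurable_normal_pdf.
- by move=> x; exact: normal_pdf_ge0.
rewrite -ge0_integralZl//; last 3 first.
- by apply: emeasurable_funM => //; exact: measurable_Ew.
- by move=> x _; rewrite mule_ge0// lee_fin.
- by rewrite lee_fin normal_peak_ge0.
apply: eq_integral => x _; rewrite normal_pdfE ?gt_eqF// muleCA; congr (_ * _).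
rewrite -EFinM; congr EFin; rewrite /normal_fun /w expr0 mul1r.
congr (_ * expR _)%R; rewrite subr0 mulNr mulrC.
by rewrite mulr_natl.
Qed.

(** The constant is chosen before [f], so testing with [f = 1] can identify it later. It is kept as
    an extended real, and its finiteness is left to that identification. *)
Lemma integral_gaussian_sqnorm n (N : probability (n.+1.-tuple R) R) :
  isotropic_gaussian beta N ->
  exists2 c : \bar R, 0 <= c & forall f : R -> \bar R,
    measurable_fun setT f -> (forall x, 0 <= f x) ->
    \int[N]_x f (\sum_(i < n.+1) tnth x i ^+ 2)%R =
    c * \int[mu]_r (f (r ^+ 2)%R * (w n r)%:E).
Proof.
have msum k : measurable_fun setT (fun x : k.-tuple R => (\sum_(i < k) tnth x i ^+ 2)%R).
  apply: measurable_sum => i; apply: measurable_funX; exact: measurable_tnth.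
have k0 : 0 <= (normal_peak beta)%:E by rewrite lee_fin normal_peak_ge0.
have msqr : measurable_fun [set: R] (fun x : R => x ^+ 2)%R by exact: measurable_funX.
elim: n N => [|n IH] N gN.
  exists (normal_peak beta)%:E => // f mf f0.
  have [N' _ ->//] := isotropic_gaussian_cons _ _ _ _ gN; last first.
    exact: (measurableT_comp mf (msum 1%N)).
  (* In dimension one the tail is empty, so the inner integral is constant and [N'] only contributes
     its mass 1. *)
  transitivity (\int[N']_y cst (\int[normal_prob 0 beta]_x f (x ^+ 2)%R) y).
    apply: eq_integral => y _; apply: eq_integral => x _.
    by rewrite big_ord_recl big_ord0 addr0.
  rewrite integral_cst// [X in _ * X](_ : _ = 1) ?mule1; last exact: probability_setT.
  rewrite integral_normal//.
  exact: measurableT_comp.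
have [N' gN' NE] := isotropic_gaussian_cons _ _ _ _ gN.
have [c c0 IHc] := IH N' gN'.
(* The new factors are the peak of the head coordinate's density and the integral over [v] produced
   by [ge0_integral_sqnorm]. *)
exists (c * (normal_peak beta)%:E * \int[mu]_v (Num.sqrt (1 + v ^+ 2) ^- n.+2)%:E).
  by rewrite !mule_ge0//; apply: integral_ge0 => x _; rewrite lee_fin.
move=> f mf f0; rewrite NE//; last exact: (measurableT_comp mf (msum n.+2)).
(* Integrating out the head leaves a function of the squared norm [u] of the tail, to which the
   induction hypothesis applies. *)
pose g (u : R) := \int[normal_prob 0 beta]_x f (x ^+ 2 + u)%R.
have g0 u : 0 <= g u by exact: integral_ge0.
have mg : measurable_fun setT g.
  apply: (measurable_fun_fubini_tonelli_F (m2 := normal_prob 0 beta)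
    (fun z : R * measurableTypeR R => f (z.2 ^+ 2 + z.1)%R)) => //.
  apply: measurableT_comp => //; apply: measurable_funD => //.
  exact: (measurableT_comp msqr measurable_snd).
transitivity (\int[N']_y g (\sum_(i < n.+1) tnth y i ^+ 2)%R).
  apply: eq_integral => y _; apply: eq_integral => x _; rewrite big_ord_recl.
  by under eq_bigr do rewrite tnthS.
rewrite IHc// -!muleA; congr (_ * _).
(* The two exponentials multiply to a function of [x^2 + r^2], so [G] absorbs both and only the
   factor [|r|^n] remains outside. *)
pose G u := f u * (expR (- ((2 * beta ^+ 2)^-1 * u)))%:E.
have mG : measurable_fun setT G.
  apply: emeasurable_funM => //; apply/measurable_EFinP.
  apply: measurableT_comp => //; apply: measurableT_comp => //.
have G0 u : 0 <= G u by rewrite mule_ge0// lee_fin expR_ge0.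
transitivity ((normal_peak beta)%:E * (\int[mu]_v (Num.sqrt (1 + v ^+ 2) ^- n.+2)%:E *
    \int[mu]_r (G (r ^+ 2)%R * (`|r| ^+ n.+1)%:E))); last first.
  congr (_ * (_ * _)); apply: eq_integral => r _.
  by rewrite /G -muleA -EFinM mulrC.
rewrite -ge0_integral_sqnorm// -ge0_integralZl//; last 2 first.
- apply: (measurable_fun_fubini_tonelli_F (m2 := mu)
    (fun z : R * R => G (z.2 ^+ 2 + z.1 ^+ 2)%R * (`|z.1| ^+ n)%:E)) => //.
  + apply: emeasurable_funM.
      apply: measurableT_comp => //.
      by apply: measurable_funD; apply: measurable_funX.
    by apply/measurable_EFinP/measurable_funX/measurableT_comp.
  + by move=> z; rewrite mule_ge0// lee_fin exprn_ge0.
- by move=> r _; apply: integral_ge0 => x _; rewrite mule_ge0// lee_fin exprn_ge0.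
apply: eq_integral => r _; rewrite /g integral_normal//; last first.
  by apply: measurableT_comp => //; exact: measurable_funD.
rewrite -muleA; congr (_ * _).
rewrite -ge0_integralZr//; last 3 first.
- apply: emeasurable_funM; last exact: measurable_Ew.
  by apply: measurableT_comp => //; exact: measurable_funD.
- by move=> x _; rewrite mule_ge0// lee_fin.
- by rewrite lee_fin.
apply: eq_integral => x _; rewrite /G -!muleA -!EFinM /w expr0 mul1r.
by congr (_ * _%:E); rewrite mulrCA -expRD mulrC mulrDr opprD.
Qed.

(** Testing with the indicator of [u <= rho^2] gives a constant times the incomplete Gamma integral
    ([lowE]); testing with 1 gives the same constant times the complete one ([TE]). Dividing
    eliminates the constant. *)
Lemma isotropic_gaussian_ball n (N : probability (n.+1.-tuple R) R) (rho : R) :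
  isotropic_gaussian beta N -> (0 <= rho)%R ->
  N [set x | (Num.sqrt (\sum_(i < n.+1) tnth x i ^+ 2) <= rho)%R] =
  ((Gamma_fun (n.+1%:R / 2))^-1 *
   lower_inc_gamma (n.+1%:R / 2) (2^-1 * (rho / beta) ^+ 2))%:E.
Proof.
move=> gN rho0; have [a a0 NE] := integral_gaussian_sqnorm _ _ gN.
pose c := ((2 * beta ^+ 2)^-1)%R.
have c0 : (0 < c)%R by rewrite invr_gt0 mulr_gt0// exprn_gt0.
pose g (t : R) := (powR t (n.+1%:R / 2 - 1) * expR (- t))%:E.
pose K := (2 * powR c (n.+1%:R / 2))%R.
have K0 : (0 < K)%R by rewrite mulr_gt0// powR_gt0.
have msum : measurable_fun setT (fun x : n.+1.-tuple R => (\sum_(i < n.+1) tnth x i ^+ 2)%R).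
  apply: measurable_sum => i; apply: measurable_funX; exact: measurable_tnth.
have w2 (D : set R) : measurable D -> D `<=` `]0%R, +oo[%classic ->
    \int[mu]_(r in D) (r ^+ n * expR (- (c * r ^+ 2)))%:E =
    \int[mu]_(r in D) (w n r)%:E.
  move=> mD D0; apply: eq_integral => r /set_mem/D0 /=; rewrite in_itv/= andbT => r0.
  by rewrite /w gtr0_norm.
have lowE : N [set x | (Num.sqrt (\sum_(i < n.+1) tnth x i ^+ 2) <= rho)%R] =
    a * (2 * K^-1)%:E * \int[mu]_(t in [set t | (0 < t <= 2^-1 * (rho / beta) ^+ 2)%R]) g t.
  pose f := (EFin \o \1_([set u : R | (u <= rho ^+ 2)%R])) : R -> \bar R.
  have mS : measurable [set u : R | (u <= rho ^+ 2)%R].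
    by rewrite -set_itvNyc.
  have mf : measurable_fun setT f by exact/measurable_EFinP/measurable_indic.
  have f0 x : 0 <= f x by rewrite lee_fin.
  transitivity (\int[N]_x f (\sum_(i < n.+1) tnth x i ^+ 2)%R).
    rewrite [X in N X](_ : _ = (fun x : n.+1.-tuple R =>
      (\sum_(i < n.+1) tnth x i ^+ 2)%R) @^-1` [set u : R | (u <= rho ^+ 2)%R]);
      last first.
      by apply/funext => x /=; rewrite -[(_ <= rho ^+ 2)%R](ler_sqrt _ (sqr_ge0 rho))
        sqrtr_sqr ger0_norm.
    rewrite -[X in N X]setIT -integral_indic//.
    by rewrite -[X in measurable X]setTI; exact: msum.
  rewrite NE// -muleA; congr (_ * _).
  (* The even integrand folds onto the positive half-line, which accounts for the 2 in
     [2 * K^-1]. *)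
  rewrite ge0_integral_even//; last 3 first.
  - apply: emeasurable_funM; last exact: measurable_Ew.
    by apply: measurableT_comp => //; exact: measurable_funX.
  - by move=> x; rewrite mule_ge0// lee_fin.
  - by move=> x; rewrite /w normrN sqrrN.
  rewrite EFinM -muleA; congr (_ * _).
  rewrite (_ : 2^-1 * _ = c * rho ^+ 2)%R; last first.
    by rewrite /c; field; rewrite gt_eqF.
  rewrite /g integral_gamma_sqr// muleA -EFinM mulVf ?gt_eqF// mul1e.
  rewrite w2//; last by move=> r /=; rewrite !in_itv/= andbT => /andP[].
  rewrite integral_mkcond [RHS]integral_mkcond; apply: eq_integral => r _.
  rewrite !patchE !mem_setE !in_itv/= /f/= indicE andbT.
  case: ltP => //= r0.
  rewrite (_ : (_ \in _) = (r <= rho)%R); last first.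
    by apply/idP/idP; rewrite inE/= ler_pXn2r ?nnegrE// ltW.
  by case: ifP; rewrite ?mul1e ?mul0e.
have TE : 1 = a * (2 * K^-1)%:E * \int[mu]_(t in [set t | (0 < t)%R]) g t.
  transitivity (\int[N]_x (cst 1 : R -> \bar R) (\sum_(i < n.+1) tnth x i ^+ 2)%R).
    by rewrite integral_cst// [X in _ * X](_ : _ = 1) ?mule1; last exact: probability_setT.
  rewrite NE// -muleA; congr (_ * _).
  under eq_integral do rewrite mul1e.
  rewrite ge0_integral_even//; last 2 first.
  - by move=> x; rewrite lee_fin.
  - by move=> x; rewrite /w normrN sqrrN.
  rewrite EFinM -muleA; congr (_ * _).
  rewrite /g (integral_gamma_sqrT _ _ _ c0) muleA -EFinM mulVf ?gt_eqF// mul1e.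
  by rewrite w2.
rewrite lowE; set L := \int[mu]_(t in [set t | (0 < t <= _)%R]) g t.
set T := \int[mu]_(t in _) g t in TE.
have g0 t : 0 <= g t by rewrite lee_fin mulr_ge0 ?powR_ge0 ?expR_ge0.
have L0 : 0 <= L by exact: integral_ge0.
have T0 : 0 <= T by exact: integral_ge0.
have mT : measurable [set t : R | (0 < t)%R] by rewrite -set_itvoy.
have mS : measurable [set t : R | (0 < t <= 2^-1 * (rho / beta) ^+ 2)%R].
  by rewrite -set_itvoc.
have mg D : measurable_fun D g.
  apply/measurable_EFinP/measurable_funTS/measurable_funM.
    exact: measurable_powR.
  by apply: measurableT_comp.
have LT : L <= T.
  apply: ge0_subset_integral => //.
  - exact: mg.
  - by move=> t /= /andP[].
rewrite /Gamma_fun /lower_inc_gamma -/L -/T.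
set b := a * _ in TE *.
have b0 : 0 <= b by rewrite mule_ge0// lee_fin mulr_ge0// invr_ge0 ltW.
(* [fine] sends infinity to 0, so finiteness must be proved: if [T] were infinite, [b * T] would be
   0 or infinite, against [TE]. *)
have Tfin : T \is a fin_num.
  rewrite ge0_fin_numE// ltey; apply/eqP => Ty; move: TE; rewrite Ty.
  move: b0; rewrite le_eqVlt => /predU1P[<-|b0].
    by rewrite mul0e => /eqP; rewrite onee_eq0.
  by rewrite gt0_muley.
have Lfin : L \is a fin_num by rewrite ge0_fin_numE// (le_lt_trans LT)// -ge0_fin_numE.
have fT : fine T != 0%R.
  by apply/eqP => T00; move: TE; rewrite -(fineK Tfin) T00 mule0 => /eqP; rewrite onee_eq0.
have -> : b = (fine T)^-1%:E.
  by rewrite -[LHS]mule1 -(divff fT) EFinM fineK// muleA -TE mul1e.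
by rewrite EFinM fineK.
Qed.
End chi.

(** * Euclidean distance: triangle inequality, rational approximation, measurability *)

Section eucl_dist_facts.
Context (R : realType).

(** Cauchy-Schwarz, from the nonnegativity of the quadratic [Q s], the sum of the squares of
    [a i - s * b i]. *)
Lemma sum_mul_le_sqrt n (a b : 'I_n -> R) :
  \sum_i a i * b i <=
  Num.sqrt (\sum_i a i ^+ 2) * Num.sqrt (\sum_i b i ^+ 2).
Proof.
set A := \sum_i a i ^+ 2; set B := \sum_i b i ^+ 2; set C := \sum_i _.
have A0 : 0 <= A by apply: sumr_ge0 => i _; exact: sqr_ge0.
have B0 : 0 <= B by apply: sumr_ge0 => i _; exact: sqr_ge0.
have [C0|C0] := leP C 0.
  by rewrite (le_trans C0)// mulr_ge0// sqrtr_ge0.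
suff CAB : C ^+ 2 <= A * B.
  by rewrite -sqrtrM// -[C]gtr0_norm// -sqrtr_sqr ler_sqrt// mulr_ge0.
have Q (s : R) : 0 <= A - 2 * s * C + s ^+ 2 * B.
  have -> : A - 2 * s * C + s ^+ 2 * B = \sum_i (a i - s * b i) ^+ 2.
    rewrite /A /B /C !mulr_sumr -sumrB -big_split/=; apply: eq_bigr => i _.
    by ring.
  by apply: sumr_ge0 => i _; exact: sqr_ge0.
have [B00|B00] := eqVneq B 0.
  (* For [B = 0] the quadratic is affine in [s]; at this point it equals -1, a contradiction. *)
  have := Q ((A + 1) / (2 * C)); rewrite B00 mulr0 addr0.
  rewrite (_ : 2 * _ * C = A + 1); last by field; rewrite gt_eqF.
  lra.
have Bp : 0 < B by rewrite lt_neqAle eq_sym B00.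
(* [C / B] is the minimiser of the quadratic. *)
have := Q (C / B).
rewrite (_ : _ + _ = A - C ^+ 2 / B); last by field.
by rewrite subr_ge0 ler_pdivrMr.
Qed.

Lemma eucl_dist_ge0 n (x y : n.-tuple R) : 0 <= eucl_dist x y.
Proof. exact: sqrtr_ge0. Qed.

Lemma eucl_distC n (x y : n.-tuple R) : eucl_dist x y = eucl_dist y x.
Proof.
by congr Num.sqrt; apply: eq_bigr => i _; rewrite -sqrrN opprB.
Qed.

Lemma eucl_dist_triangle n (y x z : n.-tuple R) :
  eucl_dist x z <= eucl_dist x y + eucl_dist y z.
Proof.
have S0 (u v : n.-tuple R) : 0 <= \sum_i (tnth u i - tnth v i) ^+ 2.
  by apply: sumr_ge0 => i _; exact: sqr_ge0.
have xyz0 : 0 <= eucl_dist x y + eucl_dist y z by rewrite addr_ge0// eucl_dist_ge0.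
rewrite -[leRHS]ger0_norm// -sqrtr_sqr ler_sqrt ?sqr_ge0// sqrrD !sqr_sqrtr//.
have := @sum_mul_le_sqrt n (fun i => tnth x i - tnth y i) (fun i => tnth y i - tnth z i).
rewrite -/(eucl_dist x y) -/(eucl_dist y z) => xyz.
apply: (@le_trans _ _ (\sum_i (tnth x i - tnth y i) ^+ 2 +
  (\sum_i (tnth x i - tnth y i) * (tnth y i - tnth z i)) *+ 2 +
  \sum_i (tnth y i - tnth z i) ^+ 2)).
  rewrite -mulr_natl mulr_sumr -!big_split/= le_eqVlt; apply/orP; left; apply/eqP.
  by apply: eq_bigr => i _; ring.
by rewrite lerD2r lerD2l ler_wMn2r.
Qed.

Lemma measurable_eucl_dist d (T : measurableType d) n (f g : T -> n.-tuple R) :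
  measurable_fun setT f -> measurable_fun setT g ->
  measurable_fun setT (fun t => eucl_dist (f t) (g t)).
Proof.
move=> /measurable_fun_tnthP mf /measurable_fun_tnthP mg.
apply: measurableT_comp.
  by apply: continuous_measurable_fun; exact: sqrt_continuous.
apply: measurable_sum => i; apply: measurable_funX.
by apply: measurable_funB; [exact: mf|exact: mg].
Qed.

Lemma rat_tuple_dense n (x : n.-tuple R) (e : R) : 0 < e ->
  exists q : {ffun 'I_n -> rat}, eucl_dist x [tuple ratr (q i) | i < n] < e.
Proof.
move=> e0.
have [del del0 ndel] : exists2 del : R, 0 < del & n%:R * del ^+ 2 < e ^+ 2.
  (* Dividing by [n + 1] keeps the bound strict, as [n < (n + 1)^2], and covers [n = 0]. *)
  exists (e / n.+1%:R); first by rewrite divr_gt0.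
  rewrite expr_div_n mulrA ltr_pdivrMr ?exprn_gt0// mulrC ltr_pM2l ?exprn_gt0//.
  by rewrite -natrX ltr_nat expnS expn1 mulnS ltn_addr.
have xq i : exists q : rat, `|tnth x i - ratr q| < del.
  have /rat_in_itvoo[q] : tnth x i - del < tnth x i + del by lra.
  rewrite in_itv/= => /andP[q1 q2]; exists q; rewrite ltr_norml; lra.
exists [ffun i => xchoose (xq i)].
rewrite -[ltRHS]gtr0_norm// -sqrtr_sqr ltr_sqrt ?exprn_gt0//.
apply: le_lt_trans ndel; rewrite mulr_natl -[n in leRHS]card_ord -sumr_const.
apply: ler_sum => i _; rewrite tnth_mktuple ffunE.
rewrite -[leLHS]ger0_norm ?sqr_ge0// normrX lerXn2r ?nnegrE// ?ltW//.
exact: (xchooseP (xq i)).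
Qed.

(* [f t] is the supremum of [f (u i) - e t i] over the countable family [u]. *)
Lemma measurable_sublevel_lipschitz d (T : measurableType d) (I : countType)
    (f : T -> R) (e : T -> I -> R) (u : I -> T) (a : R) :
  (forall i, measurable_fun setT (e ^~ i)) ->
  (forall t i, `|f t - f (u i)| <= e t i) ->
  (forall t eps, 0 < eps -> exists i, e t i < eps) ->
  measurable [set t | f t <= a].
Proof.
move=> me fe e0.
rewrite [X in measurable X](_ : _ =
  ~` \bigcup_i ((fun t => f (u i) - e t i) @^-1` `]a, +oo[%classic)); last first.
  apply/seteqP; split=> t /=.
    move=> fa [i _] /=; rewrite in_itv/= andbT.
    have := fe t i; rewrite ler_norml => /andP[]; lra.
  move=> H; rewrite leNgt; apply/negP => fa; apply: H.
  (* The error enters twice, in [f (u i) >= f t - e t i] and in the subtracted [e t i]; hence the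
     half. *)
  have [|i ei] := e0 t ((f t - a) / 2); first lra.
  exists i => //=; rewrite in_itv/= andbT.
  have := fe t i; rewrite ler_norml => /andP[]; lra.
apply: measurableC; apply: countable_bigcupT_measurable => // i.
rewrite -[X in measurable X]setTI.
by apply: measurable_funB => //; exact: measurable_itv.
Qed.
End eucl_dist_facts.

(** * Measurability of the collision event and the bound on the detection rate *)

Lemma measurable_vadd (R : realType) n :
  measurable_fun setT (fun p : n.-tuple R * n.-tuple R => vadd p.1 p.2).
Proof.
apply/measurable_fun_tnthP => i.
rewrite (_ : _ \o _ =
    fun p : n.-tuple R * n.-tuple R => tnth p.1 i + tnth p.2 i); last first.
  by apply/funext => p /=; rewrite tnth_mktuple.
by apply: measurable_funD; apply: (measurableT_comp (measurable_tnth _)).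
Qed.

(** The upper Lipschitz bound makes the feature distance Lipschitz in the pair, so its values at
    pairs of rational points determine its sublevel sets through countably many measurable
    conditions. *)
Lemma measurable_lipschitz_collision (R : realType) d y (H : d.-tuple R -> y.-tuple R)
    (K tau : R) : 0 < K ->
  (forall x1 x2, eucl_dist (H x1) (H x2) <= K * eucl_dist x1 x2) ->
  measurable [set p : d.-tuple R * d.-tuple R | eucl_dist (H p.1) (H p.2) <= tau].
Proof.
move=> K0 HK.
pose r (q : {ffun 'I_d -> rat}) : d.-tuple R := [tuple ratr (q i) | i < d].
pose e (p : d.-tuple R * d.-tuple R) (q : {ffun 'I_d -> rat} * {ffun 'I_d -> rat}) :=
  K * (eucl_dist p.1 (r q.1) + eucl_dist p.2 (r q.2)).
apply: (@measurable_sublevel_lipschitz _ _ _ _ _ e (fun q => (r q.1, r q.2))) => /=.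
- move=> q; apply: measurable_funM => //.
  by apply: measurable_funD; apply: measurable_eucl_dist.
- move=> p q; have h1 := HK p.1 (r q.1); have h2 := HK p.2 (r q.2).
  have t1 := @eucl_dist_triangle _ _ (H (r q.1)) (H p.1) (H p.2).
  have t2 := @eucl_dist_triangle _ _ (H (r q.2)) (H (r q.1)) (H p.2).
  have t3 := @eucl_dist_triangle _ _ (H p.1) (H (r q.1)) (H (r q.2)).
  have t4 := @eucl_dist_triangle _ _ (H p.2) (H p.1) (H (r q.2)).
  move: t1 t2 t3 t4; rewrite !(@eucl_distC _ _ (H (r _)) (H p.1)).
  rewrite !(@eucl_distC _ _ (H (r _)) (H p.2)).
  rewrite /e mulrDr ler_norml; lra.
- move=> p eps eps0; have eK : 0 < eps / (2 * K) by rewrite divr_gt0// mulr_gt0.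
  have [q1 h1] := @rat_tuple_dense _ _ p.1 _ eK.
  have [q2 h2] := @rat_tuple_dense _ _ p.2 _ eK.
  exists (q1, q2); rewrite /e /= mulrC -ltr_pdivlMr//.
  rewrite (_ : eps / K = eps / (2 * K) + eps / (2 * K)); first exact: ltrD.
  by field; rewrite gt_eqF.
Qed.

Lemma eucl_dist_vadd (R : realType) n (x z : n.-tuple R) :
  eucl_dist x (vadd x z) = Num.sqrt (\sum_(i < n) tnth z i ^+ 2).
Proof.
congr Num.sqrt; apply: eq_bigr => i _; rewrite tnth_mktuple.
by rewrite opprD addrA subrr add0r sqrrN.
Qed.

Theorem theorem2 (R : realType) (d y : nat) (H : d.-tuple R -> y.-tuple R)
  (KL KU : R) (D : probability (d.-tuple R) R) (beta tau : R)
  (N : probability (d.-tuple R) R) :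
  (0 < d)%N ->
  0 < KL -> KL <= KU ->
  (forall x1 x2 : d.-tuple R,
     KL * eucl_dist x1 x2 <= eucl_dist (H x1) (H x2) /\
     eucl_dist (H x1) (H x2) <= KU * eucl_dist x1 x2) ->
  (\int[(D \x D)%E]_p (eucl_dist p.1 p.2)%:E < +oo)%E ->
  0 < beta -> isotropic_gaussian beta N ->
  0 < tau ->
  let M := fine (\int[(D \x D)%E]_p (eucl_dist p.1 p.2)%:E)%E in
  let alpha_fp := (D \x D)%E [set p | eucl_dist (H p.1) (H p.2) <= tau] in
  let alpha_det := (D \x N)%E [set p | eucl_dist (H p.1) (H (vadd p.1 p.2)) <= tau] in
  (alpha_fp < 1)%E ->
  (alpha_det <=
     ((Gamma_fun (d%:R / 2))^-1 *
      lower_inc_gamma (d%:R / 2)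
        (2^-1 * ((KU / KL) * (M / beta) * (1 - fine alpha_fp)^-1) ^+ 2))%:E)%E.
Proof.
case: d H D N => [//|n] H D N _ KL0 KLU HL Moo beta0 gN tau0 M afp adet afp1.
have KU0 : 0 < KU by exact: lt_le_trans KLU.
have mfp := @measurable_lipschitz_collision _ _ _ H KU tau KU0 (fun x z => (HL x z).2).
have mdist : measurable_fun setT
    (fun p : n.+1.-tuple R * n.+1.-tuple R => eucl_dist p.1 p.2).
  exact: measurable_eucl_dist.
(* The detection event is the preimage of the collision event under [(x, z) |-> (x, x + z)]. *)
have mdet : measurable [set p : n.+1.-tuple R * n.+1.-tuple R |
    eucl_dist (H p.1) (H (vadd p.1 p.2)) <= tau].
  have mv : measurable_fun setT
      (fun p : n.+1.-tuple R * n.+1.-tuple R => (p.1, vadd p.1 p.2)).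
    by apply: measurable_fun_pair => //; exact: measurable_vadd.
  by have := mv measurableT _ mfp; rewrite setTI.
have ME : M%:E = (\int[(D \x D)%E]_p (eucl_dist p.1 p.2)%:E)%E.
  by rewrite fineK// ge0_fin_numE//; apply: integral_ge0 => p _; rewrite lee_fin eucl_dist_ge0.
pose P : probability (n.+1.-tuple R * n.+1.-tuple R)%type R := (D \x D)%E.
have afpfin : afp \is a fin_num by exact: (fin_num_measure P _ mfp).
have F1 : 0 < 1 - fine afp by rewrite subr_gt0 -lte_fin fineK.
(* Markov's inequality at level [tau / KU]: outside the collision event, the upper Lipschitz bound
   forces the queries to be at least that far apart. *)
have tauM : tau * (1 - fine afp) <= KU * M.
  have mEdist : measurable_fun setT
      (fun p : n.+1.-tuple R * n.+1.-tuple R => (eucl_dist p.1 p.2)%:E).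
    exact/measurable_EFinP.
  have := le_integral_abse (D \x D)%E measurableT mEdist (divr_gt0 tau0 KU0).
  under eq_integral do rewrite gee0_abs ?lee_fin ?eucl_dist_ge0//.
  rewrite -ME => markov.
  suff : (((tau / KU) * (1 - fine afp))%:E <= M%:E)%E.
    by rewrite lee_fin mulrAC ler_pdivrMr// [M * KU]mulrC.
  apply: le_trans markov.
  rewrite EFinM lee_wpmul2l ?lee_fin ?divr_ge0 ?(ltW tau0) ?(ltW KU0)//.
  rewrite EFinB fineK// -(probability_setC P)//.
  apply: (le_measure P); rewrite ?inE.
  - exact: measurableC.
  - by apply: emeasurable_fun_c_infty => //; exact: measurableT_comp.
  move=> p /= /negP; rewrite -ltNge => taup; split=> //.
  rewrite lee_fin ger0_norm ?eucl_dist_ge0// ler_pdivrMr// mulrC.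
  exact/ltW/(lt_le_trans taup)/(HL _ _).2.
(* This is the Markov bound on [tau], divided by [KL]; [rho / beta] is the quantity squared in the
   statement. *)
pose rho := KU * M / (KL * (1 - fine afp)).
have tau_rho : tau / KL <= rho.
  rewrite ler_pdivrMr// (_ : rho * KL = KU * M / (1 - fine afp)).
    by rewrite ler_pdivlMr.
  by rewrite /rho; field; rewrite !gt_eqF.
have rho0 : 0 <= rho by rewrite (le_trans _ tau_rho)// divr_ge0// ltW.
rewrite (_ : KU / KL * (M / beta) / (1 - fine afp) = rho / beta); last first.
  by rewrite /rho; field; rewrite !gt_eqF.
rewrite -(isotropic_gaussian_ball _ _ beta0 _ _ _ gN rho0).
set S := [set x | _].
have mS : measurable S.
  have msqrt : measurable_fun setT
      (fun x : n.+1.-tuple R => Num.sqrt (\sum_(i < n.+1) tnth x i ^+ 2)).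
    apply: measurableT_comp.
      by apply: continuous_measurable_fun; exact: sqrt_continuous.
    by apply: measurable_sum => i; apply: measurable_funX; exact: measurable_tnth.
  have := msqrt measurableT _ (measurable_itv `]-oo, rho]); rewrite setTI.
  by congr measurable; apply/seteqP; split=> x /=; rewrite in_itv.
(* The Gaussian mass of the ball is lifted to the product space, so that the claim becomes an
   inclusion of events. *)
have -> : N S = (D \x N)%E (setT `*` S).
  by rewrite product_measure1E// [X in (X * _)%E](_ : _ = 1%E) ?mul1e//; exact: probability_setT.
apply: le_measure; rewrite ?inE//; first exact: measurableX.
(* The norm of the noise is the distance from [x] to [x + z]; the lower Lipschitz bound and
   detection make it at most [tau / KL], hence at most [rho]. *)
move=> [x z] /= xz; split=> //=; rewrite /S/= -(eucl_dist_vadd _ _ x).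
apply: le_trans tau_rho; rewrite ler_pdivlMr// mulrC.
by apply: le_trans xz; exact: (HL _ _).1.
Qed.
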